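(* Let $G$ be a compact abelian group and let $G^0$ denote the connected component of the identity in $G$. If $G/G^0$ is infinite, then $\lambda(G)=0$.
   Context: For a compact abelian group $G$ with normalized Haar measure $\mu$ and (multiplicative) dual group of characters $\widehat{G}$, let $\mathbb{Z}[\widehat{G}]$ denote the ring of integral linear combinations of characters, regarded as functions on $G$. For $f\in\mathbb{Z}[\widehat{G}]$, the logarithmic Mahler measure over $G$ is $\mathsf{m}_G(f)=\int_G\log|f|\,d\mu$ (with $\log 0=-\infty$, so this may equal $-\infty$). The Lehmer constant of $G$ is $\lambda(G)=\inf\{\mathsf{m}_G(f): f\in\mathbb{Z}[\widehat{G}],\ \mathsf{m}_G(f)>0\}$. *)

(* Defs.v *)
From HB Require Import structures.
From mathcomp Require Import all_boot all_order all_algebra.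
From mathcomp Require Import all_classical all_reals all_analysis.
From mathcomp Require Import complex.

Set Implicit Arguments.
Unset Strict Implicit.
Unset Printing Implicit Defensive.

Import Order.TTheory GRing.Theory Num.Theory.
Import numFieldNormedType.Exports.
Local Open Scope classical_set_scope.
Local Open Scope ring_scope.

Definition cmod {R : realType} (z : R[i]) : R :=
  Num.sqrt (complex.Re z ^+ 2 + complex.Im z ^+ 2).

Definition elog {R : realType} (r : R) : \bar R :=
  if r == 0 then -oo%E else (ln r)%:E.

(* a topological abelian group is pointed by 0 (needed for the Borel sigma-algebra structure) *)
#[non_forgetful_inheritance]
HB.instance Definition _ (G : topologicalZmodType) := isPointed.Build G 0.

Notation Borel T := (g_sigma_algebraType (@open T)).

Definition is_character {R : realType} {G : topologicalZmodType}
  (chi : G -> R[i]) : Prop :=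
  [/\ (forall x y : G, chi (x + y) = chi x * chi y),
      (forall x : G, cmod (chi x) = 1),
      continuous (fun x : G => complex.Re (chi x)) &
      continuous (fun x : G => complex.Im (chi x))].

Definition in_ZGhat {R : realType} {G : topologicalZmodType}
  (f : G -> R[i]) : Prop :=
  exists (n : nat) (c : 'I_n -> int) (chi : 'I_n -> G -> R[i]),
    (forall i, is_character (chi i)) /\
    f = (fun x => \sum_(i < n) (c i)%:~R * chi i x).

Definition is_normalized_haar {R : realType} {G : topologicalZmodType}
  (mu : {measure set (Borel G) -> \bar R}) : Prop :=
  [/\ mu setT = 1%E,
      (forall (x : G) (A : set G), measurable (A : set (Borel G)) ->
         mu ([set x + a | a in A] : set (Borel G)) = mu A),
      (forall A : set G, measurable (A : set (Borel G)) ->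
         mu A = ereal_inf [set mu U | U in [set U : set G | open U /\ A `<=` U]]) &
      (forall U : set G, open U ->
         mu U = ereal_sup [set mu K | K in [set K : set G | compact K /\ K `<=` U]])].

Definition mahler {R : realType} {G : topologicalZmodType}
  (mu : {measure set (Borel G) -> \bar R}) (f : G -> R[i]) : \bar R :=
  (\int[mu]_(x in [set: Borel G]) elog (cmod (f (x : G))))%E.

Definition lehmer {R : realType} {G : topologicalZmodType}
  (mu : {measure set (Borel G) -> \bar R}) : \bar R :=
  ereal_inf [set mahler mu f | f in [set f : G -> R[i] | in_ZGhat f /\ (0 < mahler mu f)%E]].

Definition identity_component (G : topologicalZmodType) : set G :=
  connected_component [set: G] 0.

Definition cosets_G0 (G : topologicalZmodType) : set (set G) :=
  [set [set y | @identity_component G (y - x)] | x in [set: G]].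

(* Main.v *)
Require Import Defs.
From HB Require Import structures.
From mathcomp Require Import all_boot all_order all_algebra.
From mathcomp Require Import all_classical all_reals all_analysis.
From mathcomp Require Import complex cyclotomic separable finmap lra.
Import Order.TTheory GRing.Theory Num.Theory.
Import numFieldNormedType.Exports.
Local Open Scope classical_set_scope.
Local Open Scope ring_scope.

(** If [H] is an open subgroup of index [n], then [n 1_H] is the sum of the
    characters of [G / H], so [f = n 1_H - 1] lies in the ring of integral
    combinations of characters; as [|f|] is [n - 1] on [H] and [1] elsewhere, its
    Mahler measure is [ln (n - 1) / n], which is positive for [n > 2] and tends to
    [0].  The identity component of a compact group is the intersection of its
    open subgroups, so separating finitely many of the infinitely many cosets of
    [G^0] yields open subgroups of arbitrarily large finite index. *)

(** * Open subgroups of a topological abelian group *)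

Definition open_subgroup {G : topologicalZmodType} (H : set G) : Prop :=
  [/\ H 0, (forall x y, H x -> H y -> H (x - y)) & open H].

Section OpenSubgroups.
Variable G : topologicalZmodType.
Implicit Types H K U V : set G.

Lemma open_subgroupN H x : open_subgroup H -> H x -> H (- x).
Proof. by case=> H0 HB _ Hx; rewrite -sub0r; exact: HB. Qed.

Lemma open_subgroupD H x y : open_subgroup H -> H x -> H y -> H (x + y).
Proof.
move=> oH Hx Hy; rewrite -[y]opprK; case: (oH) => _ HB _.
by apply: HB => //; exact: open_subgroupN.
Qed.

Lemma open_subgroup_sym H x y : open_subgroup H -> H (x - y) -> H (y - x).
Proof. by move=> oH Hxy; rewrite -opprB; exact: open_subgroupN. Qed.

Lemma open_subgroup_trans H z x y :
  open_subgroup H -> H (x - z) -> H (z - y) -> H (x - y).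
Proof. by move=> oH Hxz Hzy; rewrite -(subrKA z); exact: open_subgroupD. Qed.

Lemma open_subgroupT : open_subgroup [set: G].
Proof. by split => //; exact: openT. Qed.

Lemma open_subgroupI H K :
  open_subgroup H -> open_subgroup K -> open_subgroup (H `&` K).
Proof.
move=> [H0 HB oH] [K0 KB oK]; split=> //; last exact: openI.
by move=> x y [Hx Kx] [Hy Ky]; split; [exact: HB|exact: KB].
Qed.

Lemma open_translate U x : open U -> open [set y | U (y - x)].
Proof.
move=> oU; apply: (@open_comp _ _ (fun y : G => y - x)) => // y _.
apply: (@continuous_comp _ _ _ (fun y : G => (y, x))
  (fun z : G * G => z.1 - z.2)); last exact: sub_continuous.
by apply: cvg_pair => /=; [exact: cvg_id|exact: cvg_cst].
Qed.

(** The complement is open, being a union of translates of [H]. *)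
Lemma open_subgroup_closed H : open_subgroup H -> closed H.
Proof.
move=> oH; rewrite -openC openE => x nHx /=; case: (oH) => H0 HB opH.
rewrite /interior nbhsE; exists [set y | H (y - x)].
  by split; [exact: open_translate|rewrite /= subrr].
move=> y /= Hyx Hy; apply: nHx.
by rewrite -(subKr y x); exact: HB.
Qed.

(** * The identity component of a compact group *)

Hypothesis cG : compact [set: G].

(* A clopen neighbourhood of 0 contains its own stabilizer under translation,
   which compactness makes open. *)
Lemma clopen_open_subgroup U : open U -> closed U -> U 0 ->
  exists2 H, open_subgroup H & H `<=` U.
Proof.
move=> oU cU U0; pose H := [set x | forall y, U (y + x) <-> U y].
exists H; last by move=> x Hx; have := Hx 0; rewrite add0r => ->.
split.
- by move=> y; rewrite addr0.
- move=> x y Hx Hy z; rewrite -(Hy (z + (x - y))) -[in z + _ + y]addrA subrK.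
  exact: Hx.
have addP (V : set G) y x : open V -> V (y + x) ->
    \forall z \near (y, x), V (z.1 + z.2).
  by move=> oV Vyx; apply: (@add_continuous G (y, x)); exact: open_nbhs_nbhs.
rewrite openE => x Hx /=; rewrite /interior.
(* Both [U] and its complement are open, so membership of [y'] and of [y' + x'] in [U] is constant
   near [(y, x)]; compactness then gives one neighbourhood of [x] valid for all [y]. *)
have near_stab y : [set: G] y ->
    \forall y' \near y & x' \near x, U (y' + x') <-> U y'.
  move=> _; have near_fst V : open V -> V y -> \forall z \near (y, x), V z.1.
    by move=> oV Vy; apply: (cvg_fst (F := nbhs y)); exact: open_nbhs_nbhs.
  case: (pselect (U y)) => Uy.
    have Uyx : U (y + x) by rewrite Hx.
    by apply: filterS2 (addP _ _ _ oU Uyx) (near_fst _ oU Uy) => z /= ? ?.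
  have Uyx : (~` U) (y + x) by move=> /Hx.
  have oC : open (~` U) by rewrite openC.
  by apply: filterS2 (addP _ _ _ oC Uyx) (near_fst _ oC Uy) => z /= ? ?; split.
have sub := (compact_near_coveringP _).1 cG G (nbhs x)
  (fun x y => U (y + x) <-> U y) (nbhs_filter x) near_stab.
by apply: filterS sub => x' stab y; exact: stab.
Qed.

(** A point outside [W] is missed by some open subgroup [H]; as [H] is closed, nearby points are
    missed by every subgroup of [H]. Compactness, applied along the filter [F] of ever smaller open
    subgroups, gives one subgroup missing all points outside [W]. *)
Lemma open_subgroups_sub_open W : open W ->
  (forall x, (forall H, open_subgroup H -> H x) -> W x) ->
  exists2 H, open_subgroup H & H `<=` W.
Proof.
move=> oW QW.
pose F := filter_from (@open_subgroup G)
  (fun H => [set K | open_subgroup K /\ K `<=` H]).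
have FF : Filter F.
  apply: filter_from_filter; first by exists setT; exact: open_subgroupT.
  move=> H K oH oK; exists (H `&` K); first exact: open_subgroupI.
  by move=> L /= [oL LHK]; split; split=> // x /LHK [].
have near_sub x : [set: G] x -> \forall y \near x & K \near F, K y -> W y.
  move=> _; have [Wx|nWx] := pselect (W x).
    exists (W, [set: set G]); last by move=> [y K] /= [].
    by split; [exact: open_nbhs_nbhs|exact: filterT].
  have [H oH nHx] : exists2 H, open_subgroup H & ~ H x.
    apply: contrapT => nH; apply: nWx; apply: QW => H oH.
    by apply: contrapT => nHx; apply: nH; exists H.
  exists (~` H, [set K | open_subgroup K /\ K `<=` H]).
    split; last by exists H.
    by apply: open_nbhs_nbhs; split=> //; rewrite openC; exact: open_subgroup_closed.
  by move=> [y K] /= [nHy [_ KH]] /KH.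
have [H oH HP] := (compact_near_coveringP _).1 cG (set G) F
  (fun K y => K y -> W y) FF near_sub.
by exists H => // x; apply: (HP H) => //; split.
Qed.

Hypothesis hG : hausdorff_space G.

(* The intersection of the open subgroups is connected. *)
Lemma open_subgroups_identity_component x :
  (forall H, open_subgroup H -> H x) -> identity_component x.
Proof.
pose Q := [set x | forall H, open_subgroup H -> H x] => Qx.
have Q0 : Q 0 by move=> H [].
have cQ : closed Q.
  rewrite (_ : Q = \bigcap_(H in @open_subgroup G) H)//.
  by apply: closed_bigI => H; exact: open_subgroup_closed.
(* Normality separates [A] and [B] by disjoint open sets [U] and [W], and some open subgroup [H]
   lies in their union. Then [H] meets [U] in a clopen set, which contains an open subgroup [K];
   hence [Q] lies in [U], away from [B]. *)
have split_Q (A B : set G) : closed A -> closed B -> Q `<=` A `|` B ->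
    A `&` B = set0 -> A 0 -> B `&` Q = set0.
  move=> cA cB QAB AB0 A0.
  have AnB : set_nbhs A (~` B).
    apply/set_nbhsP; exists (~` B); split=> //; first by rewrite openC.
    by apply/disjoints_subset.
  have [V /set_nbhsP [U [oU AU UV]] VB] := compact_normal hG cG cA AnB.
  pose W := ~` closure V.
  have oW : open W by rewrite openC; exact: closed_closure.
  have UW0 y : U y -> W y -> False by move=> /UV /subset_closure.
  have BW : B `<=` W by move=> y By /VB.
  have [|H oH HUW] := @open_subgroups_sub_open (U `|` W) (openU oU oW).
    by move=> y /QAB [/AU|/BW]; [left|right].
  have [|||K oK KHU] := @clopen_open_subgroup (H `&` U).
  - by apply: openI => //; case: oH.
  - rewrite (_ : H `&` U = H `&` ~` W).
      by apply: closedI; [exact: open_subgroup_closed|rewrite closedC].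
    apply/seteqP; split=> y [Hy Wy]; split=> //; first by move/(UW0 _ Wy).
    by case: (HUW _ Hy).
  - by split; [case: oH|exact: AU].
  by apply/disjoints_subset => y /BW Wy /(_ K oK) /KHU [_ /UW0]; exact.
apply: (@connected_component_max _ _ Q) => // B [b Bb] [C oC BC] [D cD BD].
(* A nonempty relatively clopen [B] is the trace on [Q] of both the open [C] and the closed [D], so
   [Q] splits into two closed pieces. If 0 lies in [B], then [split_Q] gives [B = Q]; otherwise it
   makes [B] empty. *)
have cQC : closed (Q `&` ~` C) by apply: closedI => //; rewrite closedC.
have cQD : closed (Q `&` D) by exact: closedI.
have Qcov : Q `<=` (Q `&` D) `|` (Q `&` ~` C).
  move=> y Qy; rewrite -BD BC; have [Cy|nCy] := pselect (C y); first by left.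
  by right.
have dis : (Q `&` D) `&` (Q `&` ~` C) = set0.
  by rewrite -BD BC; apply/disjoints_subset => y [_ Cy] [_].
have [Q0' | Q0'] := Qcov _ Q0.
  have /disjoints_subset QC := split_Q _ _ cQD cQC Qcov dis Q0'.
  apply/seteqP; split=> y; first by rewrite BC => -[].
  move=> Qy; rewrite BC; split=> //; apply: contrapT => nCy.
  exact: (QC y).
rewrite setUC in Qcov; rewrite setIC in dis.
have := split_Q _ _ cQC cQD Qcov dis Q0'.
by move=> /disjoints_subset /(_ b); rewrite -BD => /(_ Bb) []; rewrite BC in Bb; case: Bb.
Qed.

(** For the direct implication, an open subgroup is clopen and contains 0, so it contains every
    connected set through 0. *)
Lemma identity_componentP x :
  identity_component x <-> forall H, open_subgroup H -> H x.
Proof.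
split; last exact: open_subgroups_identity_component.
move=> [A [A0 _ cA] Ax] H oH; have [H0 _ opH] := oH.
suff AH : A `&` H = A by move: Ax; rewrite -AH => -[].
apply: cA; first by exists 0.
- by exists H.
- by exists H => //; exact: open_subgroup_closed.
Qed.

(** * Finite index, and open subgroups of large index *)

Definition coset_representatives H {n} (g : 'I_n -> G) : Prop :=
  (forall x, exists i, H (x - g i)) /\ (forall i j, H (g i - g j) -> i = j).

(** The cosets form an open cover, so compactness leaves finitely many. Writing the index as [n.+1]
    makes the matrices of that size a ring. *)
Lemma open_subgroup_coset_representatives H : open_subgroup H ->
  exists n (g : 'I_n.+1 -> G), coset_representatives H g.
Proof.
move=> oH; have [H0 HB opH] := oH; pose C x := [set y | H (y - x)].
have CE x y : H (x - y) -> C x = C y.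
  move=> Hxy; apply/seteqP; split=> z /= Hz.
    exact: (open_subgroup_trans _ x).
  by apply: (open_subgroup_trans _ y) => //; exact: open_subgroup_sym.
have : finite_set (range C).
  have := cG; rewrite compact_cover => /(_ G setT C) [].
  - by move=> x _; exact: open_translate.
  - by move=> x _; exists x => //=; rewrite /C /= subrr.
  move=> D _ cov.
  have sub : range C `<=` C @` [set` D].
    move=> _ [x _ <-]; have [y Dy Cyx] := cov x I.
    by exists y => //; apply/esym/CE.
  exact: (sub_finite_set sub (finite_image C (finite_fset D))).
move=> /finite_fsetP [X XE]; set s := enum_fset X.
have sP A : A \in s <-> range C A by rewrite XE.
have us : uniq s by exact: fset_uniq.
have [n sn] : exists n, size s = n.+1.
  have : C 0 \in s by apply/sP; exists 0.
  by case: s {sP us} => // a s _; exists (size s).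
have /choice [g gP] (i : 'I_n.+1) : exists x, C x = nth set0 s i.
  have /sP [x _ <-] : nth set0 s i \in s.
    by rewrite mem_nth// sn.
  by exists x.
exists n, g; split=> [x|i j Hij].
  have Cs : C x \in s by apply/sP; exists x.
  have lti : (index (C x) s < n.+1)%N by rewrite -sn index_mem.
  exists (Ordinal lti); have := gP (Ordinal lti); rewrite /= nth_index// => Cg.
  suff : C (g (Ordinal lti)) x by [].
  by rewrite Cg /C /= subrr.
apply/val_inj/eqP; rewrite -(nth_uniq set0 _ _ us) ?sn ?ltn_ord//.
by rewrite -!gP; apply/eqP/CE.
Qed.

Lemma open_subgroup_large_index N : infinite_set (@cosets_G0 G) ->
  exists2 H, open_subgroup H &
    exists n (g : 'I_n.+1 -> G), coset_representatives H g /\ (N <= n)%N.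
Proof.
move=> /(infinite_set_fset N.+1) [B BG NB]; set s := enum_fset B in NB.
have us : uniq s by exact: fset_uniq.
have /choice [x xP] (i : 'I_(size s)) :
    exists x, nth set0 s i = [set y | identity_component (y - x)].
  have /BG [x _ <-] : nth set0 s i \in s by rewrite mem_nth.
  by exists x.
(* If no open subgroup separated [x i] from [x j], their difference would lie in the identity
   component and the two cosets would coincide. Diagonal pairs get the whole group. *)
have /choice [K KP] (p : 'I_(size s) * 'I_(size s)) :
    exists K, open_subgroup K /\ (p.1 != p.2 -> ~ K (x p.1 - x p.2)).
  case: p => i j /=; have [->|ij] := eqVneq i j.
    by exists setT; split=> //; exact: open_subgroupT.
  apply: contrapT => nK; move/eqP: ij; apply; apply/val_inj/eqP.
  rewrite -(nth_uniq set0 _ _ us) ?ltn_ord// !xP; apply/eqP.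
  have Qij H : open_subgroup H -> H (x i - x j).
    by move=> oH; apply: contrapT => nHij; apply: nK; exists H.
  apply/seteqP; split=> z /= /identity_componentP zP;
      apply/identity_componentP => H oH.
    by apply: (open_subgroup_trans _ (x i)) => //; [exact: zP|exact: Qij].
  apply: (open_subgroup_trans _ (x j)) => //; first exact: zP.
  by apply: open_subgroup_sym => //; exact: Qij.
pose H := \big[setI/setT]_p K p.
have oH : open_subgroup H.
  apply: big_ind; [exact: open_subgroupT|exact: open_subgroupI|].
  by move=> p _; case: (KP p).
exists H => //; have [n [g [gc gi]]] := open_subgroup_coset_representatives _ oH.
exists n, g; split=> //.
(* The intersection [H] separates all the [x i] at once, so sending [i] to the [H]-coset of [x i] is
   injective: at least [N.+1] cosets among [n.+1]. *)
have [r rP] := choice (fun i => gc (x i)).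
have r_inj : injective r.
  move=> i j rij; apply/eqP; apply: contraT => ij.
  have [_ /(_ ij) /=] := KP (i, j); case.
  have : H (x i - x j).
    apply: (open_subgroup_trans _ (g (r i))) => //; rewrite rij.
    exact: open_subgroup_sym.
  by rewrite /H (bigD1 (i, j))//= => -[].
by have := leq_card r r_inj; rewrite !card_ord => /(leq_trans NB).
Qed.

End OpenSubgroups.

(** * Characters of a finite quotient *)

Lemma diagonalizable_finite_order (F : numClosedFieldType) n (A : 'M[F]_n.+1) d :
  (0 < d)%N -> A ^+ d = 1 -> diagonalizable A.
Proof.
move=> d0 Ad; apply/diagonalizableP.
(* In characteristic zero ['X^d - 1] is separable, and it annihilates [A]. *)
have [rs E] := closed_field_poly_normal ('X^d - 1 : {poly F}).
rewrite (monicP (monicXnsubC 1 d0)) scale1r in E.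
exists rs; last first.
  rewrite -E; apply: mxminpoly_min.
  by rewrite rmorphB rmorphXn /= horner_mx_X rmorph1 Ad subrr.
by rewrite -separable_prod_XsubC -E separable_Xn_sub_1// pnatr_eq0 -lt0n.
Qed.

Lemma cmodE (R : realType) (z : R[i]) : (cmod z)%:C%C = `|z|.
Proof. by rewrite normc_def. Qed.

Lemma cmod_nat (R : realType) (m : nat) : cmod (m%:R : R[i]) = m%:R.
Proof. by apply: complexI; rewrite cmodE normr_nat rmorph_nat. Qed.

Lemma cmodN (R : realType) (z : R[i]) : cmod (- z) = cmod z.
Proof. by apply: complexI; rewrite !cmodE normrN. Qed.

Lemma cmod_unity_root (R : realType) (z : R[i]) d :
  (0 < d)%N -> z ^+ d = 1 -> cmod z = 1.
Proof.
move=> d0 zd; have : `|z| ^+ d = 1 by rewrite -normrX zd normr1.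
move/eqP; rewrite pexpr_eq1// => /eqP.
by rewrite normc_def => -[].
Qed.

Section CosetCharacters.
Variables (R : realType) (G : topologicalZmodType) (H : set G).
Hypothesis oH : open_subgroup H.
Variables (n : nat) (g : 'I_n.+1 -> G).
Hypothesis gH : coset_representatives G H g.

Lemma continuous_coset_invariant (f : G -> R) :
  (forall x y, H (x - y) -> f x = f y) -> continuous f.
Proof.
move=> fH x; apply: (@cvg_near_cst G R (f x) f (nbhs x)).
have [H0 _ opH] := oH.
have : nbhs x [set y | H (y - x)].
  by apply: open_nbhs_nbhs; split; [exact: open_translate|rewrite /= subrr].
by apply: filterS => y /= Hyx; exact: fH.
Qed.

(** Pigeonhole: two of the [n.+2] first multiples of [x] share one of the [n.+1] cosets. *)
Lemma multiple_in_open_subgroup x : exists2 d, (0 < d)%N & H (x *+ d).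
Proof.
have [r rP] := choice (fun k : 'I_n.+2 => gH.1 (x *+ k)).
have : ~~ injectiveb r.
  apply/injectiveP => /leq_card; rewrite !card_ord ltnn//.
move=> /injectivePn [i [j ij rij]].
wlog lij : i j ij rij / (j < i)%N.
  move=> W; have [lij|lij|/val_inj E] := ltngtP i j.
  - by apply: (W j i) => //; rewrite eq_sym.
  - exact: (W i j).
  - by rewrite E eqxx in ij.
exists (i - j)%N; first by rewrite subn_gt0.
rewrite mulrnBr 1?ltnW//; apply: (open_subgroup_trans G H (g (r i))) => //.
by rewrite rij; exact: open_subgroup_sym.
Qed.

(* The trace of the permutation representation of [G] on [G / H] is [#|G / H|]
   times the indicator of [H]; diagonalizing simultaneously the commuting
   permutation matrices writes it as a sum of characters. *)
Lemma sum_coset_characters :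
  exists chi : 'I_n.+1 -> G -> R[i], (forall i, is_character (chi i)) /\
    forall x, \sum_i chi i x = (n.+1 * `[< H x >])%:R.
Proof.
have [H0 HB opH] := oH; have [gc gi] := gH.
have [r rP] := choice gc.
have rE x y : (r x == r y) = `[< H (x - y) >].
  apply/eqP/asboolP => [rxy|Hxy].
    apply: (open_subgroup_trans _ _ (g (r x))) => //; rewrite rxy.
    exact: open_subgroup_sym.
  apply: gi; apply: (open_subgroup_trans _ _ x) => //.
    exact: open_subgroup_sym.
  exact: (open_subgroup_trans _ _ y).
have rg i : r (g i) = i by apply: gi; apply: open_subgroup_sym.
(* The permutation matrix of translation by [x] on the cosets, [r] being the coset index. *)
pose M x : 'M[R[i]]_n.+1 := \matrix_(i, j) (r (x + g i) == j)%:R.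
have MD x y : M (x + y) = M x *m M y.
  apply/matrixP => i k; rewrite !mxE (bigD1 (r (x + g i)))//= big1 => [|j ji].
    rewrite !mxE eqxx mul1r addr0; congr ((_ == k)%:R); apply/eqP; rewrite rE.
    by apply/asboolP; rewrite [x + y + _]addrAC addrKA.
  by rewrite !mxE [_ == j]eq_sym (negbTE ji) mul0r.
have MH x y : H (x - y) -> M x = M y.
  move=> Hxy; apply/matrixP => i j; rewrite !mxE; congr ((_ == j)%:R).
  by apply/eqP; rewrite rE; apply/asboolP; rewrite [y + _]addrC addrKA.
have M0 : M 0 = 1%:M by apply/matrixP => i j; rewrite !mxE add0r rg.
have MX x d : M (x *+ d) = M x ^+ d.
  by elim: d => [|d IH]; rewrite ?mulr0n ?M0// mulrS exprS MD IH.
have trM x : \tr (M x) = (n.+1 * `[< H x >])%:R.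
  rewrite /mxtrace (eq_bigr (fun=> (`[< H x >])%:R)) => [|i _].
    by rewrite sumr_const card_ord natrM [RHS]mulr_natl.
  by rewrite mxE -{2}(rg i) rE addrK.
(* These finitely many matrices suffice, since [M x] depends only on the coset of [x]. They commute
   because [G] is abelian, and each has finite order. *)
have [P Pu Pdiag] : codiagonalizable [seq M (g i) | i <- enum 'I_n.+1].
  apply/codiagonalizableP; split=> [_ _ /mapP[i _ ->] /mapP[j _ ->]|_ /mapP[i _ ->]].
    by rewrite /comm_mx -!MD addrC.
  have [d d0 Hd] := multiple_in_open_subgroup (g i).
  apply: (@diagonalizable_finite_order _ _ _ d) => //.
  by rewrite -MX (MH _ 0) ?M0 ?subr0.
pose D x := P *m M x *m invmx P.
have Ddiag x i j : i != j -> D x i j = 0.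
  move=> ij.
  have /(allP Pdiag) /= : M (g (r x)) \in [seq M (g i) | i <- enum 'I_n.+1].
    by apply/mapP; exists (r x); rewrite ?mem_enum.
  by rewrite -(MH _ _ (rP x)) => /similar_diagPp /(_ i j ij); rewrite conjumx.
have DD x y : D (x + y) = D x *m D y.
  by rewrite /D MD !mulmxA mulmxKV.
have D0 : D 0 = 1%:M by rewrite /D M0 mulmx1 mulmxV.
have DH x y : H (x - y) -> D x = D y by move=> Hxy; rewrite /D (MH _ _ Hxy).
have chiD i x y : D (x + y) i i = D x i i * D y i i.
  rewrite DD mxE (bigD1 i)//= big1 ?addr0// => j ji.
  by rewrite Ddiag 1?eq_sym// mul0r.
have chiX i x d : D (x *+ d) i i = D x i i ^+ d.
  elim: d => [|d IH]; first by rewrite mulr0n D0 mxE eqxx.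
  by rewrite mulrS exprS chiD IH.
exists (fun i x => D x i i); split=> [i|x]; last first.
  rewrite -trM -[LHS]/(\tr (P *m M x *m invmx P)).
  by rewrite mxtrace_mulC mulmxA mulVmx// mul1mx.
split.
- exact: chiD.
(* The values are roots of unity, as [D] is trivial on [H]. *)
- move=> x; have [d d0 Hd] := multiple_in_open_subgroup x.
  apply: (@cmod_unity_root _ _ d) => //.
  by rewrite -chiX (DH _ 0) ?subr0// D0 mxE eqxx.
- by apply: continuous_coset_invariant => x y /DH ->.
- by apply: continuous_coset_invariant => x y /DH ->.
Qed.

End CosetCharacters.

(** * Haar and Mahler measures attached to an open subgroup *)

Lemma ln_over_nat_small (R : realType) (e : R) : 0 < e ->
  exists N : nat, forall n, (N <= n)%N -> ln n%:R / n.+1%:R <= e.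
Proof.
move=> e0; exists (Num.bound ((2 / e) ^+ 2)).+1 => n Nn.
have n0 : 0 < n%:R :> R by rewrite ltr0n (leq_trans _ Nn).
have s0 : 0 < Num.sqrt n%:R :> R by rewrite sqrtr_gt0.
have sE : Num.sqrt n%:R ^+ 2 = n%:R :> R by rewrite sqr_sqrtr// ltW.
have es : 2 / e <= Num.sqrt n%:R.
  rewrite -ler_sqr ?nnegrE ?sE ?ltW ?divr_gt0//.
  apply: (lt_trans (archi_boundP _)); first by rewrite exprn_ge0// ltW// divr_gt0.
  by rewrite ltr_nat.
have se : 2 <= e * Num.sqrt n%:R by rewrite mulrC -ler_pdivrMr.
have lnE : ln n%:R = ln (Num.sqrt n%:R) *+ 2 :> R by rewrite -lnXn// sE.
have lt := ln_sublinear s0.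
rewrite ler_pdivrMr ?ltr0n// lnE -natr1 -[in leRHS]sE.
move: s0 se lt; set s := Num.sqrt _; set l := ln s => s0 se lt.
nra.
Qed.

Section HaarCosets.
Variables (R : realType) (G : topologicalZmodType).
Variable mu : {measure set (Borel G) -> \bar R}.
Hypothesis haar : is_normalized_haar mu.
Variables (H : set G) (n : nat) (g : 'I_n.+1 -> G).
Hypotheses (oH : open_subgroup H) (gH : coset_representatives G H g).

Let measurable_open (U : set G) : open U -> measurable (U : set (Borel G)).
Proof. exact: sub_sigma_algebra. Qed.

(** The [n.+1] cosets partition [G] and have equal measure by invariance. *)
Lemma haar_open_subgroup : mu H = (n.+1%:R^-1)%:E.
Proof.
have [H0 HB opH] := oH; have [gc gi] := gH; have [mu1 inv _ _] := haar.
pose F i : set (Borel G) := [set g i + a | a in H].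
have FE i : F i = [set y | H (y - g i)].
  apply/seteqP; split=> [_ [a Ha <-]|y Hy] /=; first by rewrite addrC addKr.
  by exists (y - g i) => //; rewrite addrC subrK.
have mF i : measurable (F i).
  by apply: measurable_open; rewrite FE; exact: open_translate.
have muF i : mu (F i) = mu H by apply: inv; exact: measurable_open.
have UF : \big[setU/set0]_(i < n.+1) F i = setT.
  apply/seteqP; split=> // x _; have [i Hi] := gc x.
  by rewrite (bigD1 i)//= FE; left.
have tF : trivIset setT F.
  move=> i j _ _ [x []]; rewrite !FE /= => Hi Hj; apply: gi.
  by apply: (open_subgroup_trans _ _ x) => //; exact: open_subgroup_sym.
have : (\sum_(i < n.+1) mu (F i) = 1)%E.
  by rewrite -measure_semi_additive_ord ?UF.
rewrite (eq_bigr (fun=> mu H)) => [|i _]; last exact: muF.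
(* Finiteness lets the equation be solved in [R]. *)
have : (mu H \is a fin_num)%E.
  rewrite ge0_fin_numE//; apply: (@le_lt_trans _ _ 1%E); last exact: ltry.
  rewrite -mu1; apply: le_measure => //; apply/mem_set.
    exact: measurable_open.
  exact: measurableT.
case: (mu H) => // m _; rewrite sumEFin sumr_const card_ord => -[mn]; congr EFin.
by apply: (mulIf (x := n.+1%:R)); rewrite ?pnatr_eq0// mulVf ?pnatr_eq0// mulr_natr.
Qed.

Lemma mahler_coset_indicator (f : G -> R[i]) : (0 < n)%N ->
  (forall x, f x = (n.+1 * `[< H x >])%:R - 1) ->
  mahler mu f = (ln n%:R / n.+1%:R)%:E.
Proof.
move=> n0 fE; have [_ _ opH] := oH; rewrite /mahler.
(* The index being [n.+1], the modulus is [n] on [H], nonzero so that [elog] is finite, and 1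
   elsewhere, where the logarithm vanishes. *)
have -> : (fun x : Borel G => elog (cmod (f x))) =
    (fun x => (ln n%:R)%:E) \_ (H : set (Borel G)).
  apply/funext => x; rewrite patchE /elog fE.
  have [Hx|nHx] := pselect (H x).
    by rewrite mem_set// asboolT// muln1 -natr1 addrK cmod_nat pnatr_eq0 gtn_eqF.
  rewrite memNset// asboolF// muln0 sub0r cmodN -[1]/(1%:R) cmod_nat.
  by rewrite oner_eq0 ln1.
rewrite -integral_mkcond integral_cst; last exact: measurable_open.
by rewrite haar_open_subgroup -EFinM.
Qed.

Lemma in_ZGhat_coset_indicator :
  in_ZGhat (fun x => (n.+1 * `[< H x >])%:R - 1 : R[i]).
Proof.
have [chi [chiC chiE]] := sum_coset_characters R G H oH n g gH.
(* Index [ord0] carries the trivial character with coefficient -1; the others carry the coset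
   characters with coefficient 1. *)
exists n.+2, (fun i => if unlift ord0 i is Some j then 1 else -1).
exists (fun i => if unlift ord0 i is Some j then chi j else fun=> 1); split.
  move=> i; case: unliftP => [j _|_]; first exact: chiC.
  split=> [x y|x||]; rewrite ?mul1r//.
  - by rewrite /cmod /= expr1n expr0n addr0 sqrtr1.
  - exact: cst_continuous.
  - exact: cst_continuous.
apply/funext => x; rewrite big_ord_recl unlift_none mulr1 rmorphN1 addrC.
congr (_ + _); rewrite -chiE; apply: eq_bigr => i _.
by rewrite liftK mul1r.
Qed.

End HaarCosets.

Theorem theorem5p1 (R : realType) (G : topologicalZmodType)
  (mu : {measure set (Borel G) -> \bar R}) :
  hausdorff_space G -> compact [set: G] ->
  is_normalized_haar mu ->
  infinite_set (@cosets_G0 G) ->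
  lehmer mu = 0%E.
Proof.
move=> hG cG haar infG; apply/eqP; rewrite eq_le; apply/andP; split; last first.
  by apply: le_ereal_inf_tmp => _ [f [_ f0] <-]; exact: ltW.
apply/lee_addgt0Pr => e e0; rewrite add0e.
have [N NP] := ln_over_nat_small R e e0.
(* The extra 2 forces [1 < n], so that [ln n] and the Mahler measure are strictly positive. *)
have [H oH [n [g [gH Nn]]]] := open_subgroup_large_index G cG hG (N + 2) infG.
have n1 : (1 < n)%N by rewrite (leq_trans _ Nn)// addn2.
pose f x : R[i] := (n.+1 * `[< H x >])%:R - 1.
have mf : mahler mu f = (ln n%:R / n.+1%:R)%:E.
  by apply: (mahler_coset_indicator _ _ _ haar H n g oH gH) => //; exact: ltnW.
apply: (@le_trans _ _ (mahler mu f)).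
  apply: ereal_inf_lbound; exists f => //; split.
    exact: (in_ZGhat_coset_indicator R G H n g oH gH).
  by rewrite mf lte_fin divr_gt0 ?ltr0n// ln_gt0// ltr1n.
by rewrite mf lee_fin NP// (leq_trans _ Nn)// leq_addr.
Qed.
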